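(* Let $n \geq 1$ be an integer with prime factorization $n = p_1^{\alpha_1} p_2^{\alpha_2} \cdots p_\omega^{\alpha_\omega}$, where $p_1,\ldots,p_\omega$ are distinct primes and $\alpha_1,\ldots,\alpha_\omega \geq 1$ are integers (with $\omega = 0$, empty products equal to $1$ and empty sums equal to $0$ when $n=1$), and let $\Omega = \alpha_1 + \alpha_2 + \cdots + \alpha_\omega$. Then $$\kappa_0(n) = \sum_{i=0}^{\Omega} \sum_{j=0}^i (-1)^{i-j} \binom{i}{j} \prod_{k=1}^\omega \binom{\alpha_k + j}{\alpha_k},$$ and if $n \geq 2$ then moreover $\kappa_0(n) = 2K(n)$, so that $2K(n)$ is given by the same expression.
   Context: The arithmetic functions $K$ (number of ordered factorizations of $n$ into integers greater than one) and $\kappa_0$ (number of recursive divisors of $n$) are defined on positive integers $n$ by the recursions $$K(n) = \varepsilon(n) + \sum_{d \mid n,\ d < n} K(d), \qquad \kappa_0(n) = 1 + \sum_{d \mid n,\ d < n} \kappa_0(d),$$ where $\varepsilon(1) = 1$ and $\varepsilon(n) = 0$ for $n \geq 2$, and the sums run over the proper positive divisors $d$ of $n$ (divisors $d$ with $d<n$, including $d=1$ when $n\ge 2$; the sums are empty when $n=1$). *)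

(* Defs.v *)
From mathcomp Require Import all_boot all_order all_algebra.
Set Implicit Arguments.
Unset Strict Implicit.
Unset Printing Implicit Defensive.

(* [divrec_fuel c m n] unfolds m times the recursion
     f n = c n + \sum_(d | n, d < n) f d;
   m = n unfoldings suffice for every n >= 1 (see [divrecE]). *)
Fixpoint divrec_fuel (c : nat -> nat) (m n : nat) : nat :=
  if m is m'.+1
  then c n + \sum_(1 <= d < n | d %| n) divrec_fuel c m' d
  else 0.

Definition divrec (c : nat -> nat) (n : nat) : nat := divrec_fuel c n n.

Definition eps (n : nat) : nat := if n == 1 then 1 else 0.

(* The values at n = 0 are junk: K and kappa0 are only meant for n >= 1. *)
Definition K (n : nat) : nat := divrec eps n.

Definition kappa0 (n : nat) : nat := divrec (fun=> 1) n.

Lemma divrec_fuelE c m n : 0 < n <= m -> divrec_fuel c m n = divrec c n.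
Proof.
rewrite /divrec; elim: m {-2}m (leqnn m) n => [|b IHb] m le_mb n.
  by move: le_mb; rewrite leqn0 => /eqP-> /andP[]; case: n.
case/andP; case: n => // n _; case: m le_mb => // m le_mb le_nm /=.
congr (_ + _); apply: congr_big_nat => // d /andP[_ /andP[d_gt0 lt_dn]].
have le_dm : d <= m by exact: leq_trans lt_dn le_nm.
rewrite IHb ?d_gt0 //; symmetry; apply: IHb; last by rewrite d_gt0.
exact: leq_trans le_nm le_mb.
Qed.

Lemma divrecE c n :
  0 < n -> divrec c n = c n + \sum_(1 <= d < n | d %| n) divrec c d.
Proof.
case: n => // n _; rewrite {1}/divrec /=; congr (_ + _).
apply: congr_big_nat => // d /andP[_ /andP[d_gt0 lt_dn]].
by rewrite divrec_fuelE // d_gt0.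
Qed.

Lemma KE n : 0 < n -> K n = eps n + \sum_(1 <= d < n | d %| n) K d.
Proof. exact: divrecE. Qed.

Lemma kappa0E n : 0 < n -> kappa0 n = 1 + \sum_(1 <= d < n | d %| n) kappa0 d.
Proof. exact: divrecE. Qed.

(* Main.v *)
Require Import Defs.
From mathcomp Require Import all_boot all_order all_algebra.
From mathcomp Require Import zify.
Import GRing.Theory.
Local Open Scope ring_scope.

(** Let [T] be the operator that sends an arithmetic function [f] to
    [n |-> \sum_(d | n) f d], and let [P = T - 1] be the sum over proper
    divisors.  The recursion says [kappa0 = 1 + P kappa0]; unfolding it gives
    [kappa0 = \sum_i P^i 1].  A term [P^i 1] at [n] counts the chains of [i]
    successive proper divisors below [n], and each step down loses a prime
    factor, so only [i <= Omega n] contributes ([kappa0_strict_chains]).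

    The binomial theorem applied to [(T - 1)^i] expresses [P^i 1] as the
    alternating sum of the [T^j 1], [j <= i] ([strict_chains]).  The function
    [T^j 1] ([divisor_chains]) has a closed form: [T] preserves multiplicative
    functions because the divisors of a product of coprime numbers are the
    products of their divisors, and on a prime power [p ^ a] each application
    of [T] is a partial sum along a diagonal of Pascal's triangle, so that
    [T^j 1] takes the value ['C(a + j, a)] there ([divisor_chains_prod]).

    Finally [kappa0 + eps] and [2 K] satisfy the same recursion, because [eps]
    sums to [1] over the divisors of any positive integer ([kappa0_eps]). *)

Lemma eq_sum_divisors (R : nmodType) (n : nat) (F : nat -> R) :
  (0 < n)%N ->
  \sum_(d <- divisors n) F d = F n + \sum_(1 <= d < n | (d %| n)%N) F d.
Proof.
move=> n_gt0.
have: perm_eq (divisors n) [seq d <- index_iota 1 n.+1 | (d %| n)%N].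
  apply: uniq_perm; rewrite ?divisors_uniq ?filter_uniq ?iota_uniq // => d.
  rewrite -dvdn_divisors // mem_filter mem_index_iota ltnS.
  case dn: (d %| n)%N => //=.
  by rewrite (dvdn_gt0 n_gt0 dn) dvdn_leq.
move/(perm_big _)=> -> /=.
by rewrite big_filter big_mkcond big_nat_recr //= dvdnn -big_mkcond addrC.
Qed.

(** For coprime [m] and [n], a divisor [d] of [m * n] splits in exactly one way,
    as [gcdn d m * gcdn d n]. *)
Lemma perm_divisorsM (m n : nat) :
  (0 < m)%N -> (0 < n)%N -> coprime m n ->
  perm_eq (divisors (m * n)) [seq (d * e)%N | d <- divisors m, e <- divisors n].
Proof.
move=> m_gt0 n_gt0 co_mn.
have gcd_recover a b d e :
    coprime a b -> (d %| a -> e %| b -> gcdn a (d * e) = d)%N.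
  move=> co_ab da eb; rewrite Gauss_gcdl; first by apply/gcdn_idPr.
  by apply: coprime_dvdr eb _.
apply: uniq_perm; first exact: divisors_uniq.
  apply: allpairs_uniq; rewrite ?divisors_uniq // => ? ?.
  move=> /allpairsP[[d e] /= [dm en ->]] /allpairsP[[d' e'] /= [d'm e'n ->]].
  move: dm en d'm e'n; rewrite -!dvdn_divisors // => dm en d'm e'n /= eq_de.
  congr (_, _).
    by rewrite -(gcd_recover m n d e) // eq_de (gcd_recover m n).
  have co_nm: coprime n m by rewrite coprime_sym.
  by rewrite -(gcd_recover n m e d) // mulnC eq_de mulnC (gcd_recover n m).
move=> d; rewrite -dvdn_divisors ?muln_gt0 ?m_gt0 //.
apply/idP/allpairsP => [d_mn | [[a b] /= [am bn ->]]]; last first.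
  by rewrite dvdn_mul // dvdn_divisors.
exists (gcdn d m, gcdn d n); rewrite -!dvdn_divisors // !dvdn_gcdr; split=> //=.
apply/eqP; rewrite eqn_dvd Gauss_dvd ?dvdn_gcdl ?andbT; last first.
  exact: coprime_dvdl (dvdn_gcdr _ _) (coprime_dvdr (dvdn_gcdr _ _) co_mn).
rewrite muln_gcdl !muln_gcdr !dvdn_gcd d_mn dvdn_mulr //= dvdn_mulr //=.
by rewrite dvdn_mull.
Qed.

Lemma perm_divisorsX (p a : nat) :
  prime p ->
  perm_eq (divisors (p ^ a)) [seq (p ^ i)%N | i <- index_iota 0 a.+1].
Proof.
move=> p_pr; apply: uniq_perm; first exact: divisors_uniq.
  rewrite map_inj_uniq ?iota_uniq // => i j /eqP.
  by rewrite eqn_exp2l ?prime_gt1 // => /eqP.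
move=> d; rewrite -dvdn_divisors ?expn_gt0 ?prime_gt0 //.
apply/(dvdn_pfactor _ _ p_pr)/mapP => [] [i].
  by move=> ia ->; exists i; rewrite // mem_index_iota ltnS.
by rewrite mem_index_iota ltnS => ia ->; exists i.
Qed.

(** The function [T^j 1]; its value at [n] is the number of chains
    [d_1 %| d_2 %| ... %| d_j %| n], repetitions being allowed. *)
Fixpoint divisor_chains (j n : nat) : nat :=
  if j is j'.+1 then (\sum_(d <- divisors n) divisor_chains j' d)%N else 1%N.

Lemma divisor_chains1 (j : nat) : divisor_chains j 1 = 1%N.
Proof. by elim: j => //= j IHj; rewrite big_seq1. Qed.

Lemma divisor_chainsM (j m n : nat) :
  (0 < m)%N -> (0 < n)%N -> coprime m n ->
  divisor_chains j (m * n) = (divisor_chains j m * divisor_chains j n)%N.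
Proof.
elim: j m n => //= j IHj m n m_gt0 n_gt0 co_mn.
rewrite (perm_big _ (perm_divisorsM _ _ m_gt0 n_gt0 co_mn)) big_allpairs_dep /=.
rewrite big_distrl /= big_seq [RHS]big_seq; apply: eq_bigr => d.
rewrite -dvdn_divisors // => dm.
rewrite big_distrr /= big_seq [RHS]big_seq; apply: eq_bigr => e.
rewrite -dvdn_divisors // => en.
rewrite IHj ?(dvdn_gt0 m_gt0 dm) ?(dvdn_gt0 n_gt0 en) //.
exact: coprime_dvdl dm (coprime_dvdr en co_mn).
Qed.

(** By induction on [j] this is the hockey-stick identity, the sum of the
    ['C(i + j, i)] for [i <= a] being ['C(a + j.+1, a)]. *)
Lemma divisor_chainsX (j p a : nat) :
  prime p -> divisor_chains j (p ^ a) = 'C(a + j, a).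
Proof.
move=> p_pr; elim: j a => [|j IHj] a /=; first by rewrite addn0 binn.
rewrite (perm_big _ (perm_divisorsX _ a p_pr)) big_map /=.
elim: a => [|a IHa]; first by rewrite big_nat1 IHj !bin0.
by rewrite big_nat_recr //= IHa IHj [in RHS]addSn binS addnS -addSn addnC.
Qed.

Lemma divisor_chains_prod (j omega : nat) (p alpha : 'I_omega -> nat) :
  (forall k, prime (p k)) -> injective p ->
  divisor_chains j (\prod_(k < omega) p k ^ alpha k)
    = (\prod_(k < omega) 'C(alpha k + j, alpha k))%N.
Proof.
move=> p_pr p_inj; elim: (index_enum _) (index_enum_uniq 'I_omega) => [|k r IHr].
  by move=> _; rewrite !big_nil divisor_chains1.
case/andP=> k_r r_uniq; rewrite !big_cons divisor_chainsM.
- by rewrite divisor_chainsX // IHr.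
- by rewrite expn_gt0 prime_gt0.
- by rewrite prodn_gt0 // => i; rewrite expn_gt0 prime_gt0.
rewrite big_seq; elim/big_rec: _ => [|i x i_r co_x].
  exact: coprimen1.
rewrite coprimeMr co_x andbT.
apply: coprimeXl; apply: coprimeXr; rewrite prime_coprime // dvdn_prime2 //.
by apply: contra k_r => /eqP/p_inj->.
Qed.

(** Both sides are the [i.+1]-st finite difference of [u] at [0]; on the right,
    one difference has been taken termwise.  Applied to [u j = T^j 1], it turns
    [(T - 1)^i.+1] into [(T - 1)^i] composed with [T - 1]. *)
Lemma binomial_differenceS (u : nat -> int) (i : nat) :
  \sum_(j < i.+2) (-1) ^+ (i.+1 - j) * ('C(i.+1, j))%:Z * u j
    = \sum_(j < i.+1) (-1) ^+ (i - j) * ('C(i, j))%:Z * (u j.+1 - u j).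
Proof.
under [RHS]eq_bigr => j _ do rewrite mulrBr.
(* The terms in [u 0] are set apart and matched; the others are then compared
   through Pascal's rule. *)
rewrite sumrB [X in _ = _ - X]big_ord_recl [LHS]big_ord_recl /=.
rewrite !subn0 !bin0 !mulr1 opprD addrCA exprS mulN1r mulNr; congr (_ + _).
under eq_bigr => j _ do
  rewrite /bump /= add1n subSS binS PoszD mulrDr mulrDl addrC.
rewrite big_split; congr (_ + _).
(* The top index contributes ['C(i, i.+1) = 0]. *)
rewrite big_ord_recr /= bin_small // mulr0 mul0r addr0 -sumrN.
apply: eq_bigr => j _; rewrite /bump /= add1n -!mulNr; congr (_ * _ * _).
by rewrite -[in LHS]subnSK // exprS mulN1r.
Qed.

(** The number of prime factors counted with multiplicity.  Any bound at least
    [n] on the summation index gives the same value ([bigomega_widen]), which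
    lets different arguments be compared over a common range. *)
Definition bigomega (n : nat) : nat := (\sum_(q < n.+1) logn q n)%N.

Lemma bigomega_widen (n N : nat) :
  (n <= N)%N -> bigomega n = (\sum_(q < N.+1) logn q n)%N.
Proof.
move=> le_nN; rewrite /bigomega -!(big_mkord xpredT (logn^~ n)).
rewrite [RHS](big_cat_nat _ (n := n.+1)) //=.
rewrite [X in _ = (_ + X)%N]big1_seq ?addn0 //.
by move=> q; rewrite mem_index_iota => /and3P[_ /ltn_log0->].
Qed.

Lemma bigomegaM (m n : nat) :
  (0 < m)%N -> (0 < n)%N -> bigomega (m * n) = (bigomega m + bigomega n)%N.
Proof.
move=> m_gt0 n_gt0.
rewrite (bigomega_widen _ _ (leq_pmulr m n_gt0)).
rewrite (bigomega_widen _ _ (leq_pmull n m_gt0)) -big_split.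
by apply: eq_bigr => q _; rewrite lognM.
Qed.

Lemma bigomega1 : bigomega 1 = 0%N.
Proof. by rewrite /bigomega big1 // => q _; rewrite logn1. Qed.

Lemma bigomega_prime (p : nat) : prime p -> bigomega p = 1%N.
Proof.
move=> p_pr; rewrite /bigomega (bigD1 ord_max) //= logn_prime // eqxx.
by rewrite big1 // => q; rewrite -val_eqE /= logn_prime // => /negPf->.
Qed.

Lemma bigomega_gt0 (n : nat) : (1 < n)%N -> (0 < bigomega n)%N.
Proof.
move=> n_gt1; have n_gt0 := ltnW n_gt1.
have /dvdnP[m def_n] := pdiv_dvd n; have p_pr := pdiv_prime n_gt1.
rewrite def_n bigomegaM; first by rewrite (bigomega_prime _ p_pr) addn1.
  by move: n_gt0; rewrite {1}def_n muln_gt0 => /andP[].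
exact: prime_gt0.
Qed.

Lemma ltn_bigomega (d n : nat) :
  (0 < d < n)%N -> (d %| n)%N -> (bigomega d < bigomega n)%N.
Proof.
case/andP=> d_gt0 lt_dn /dvdnP[e def_n]; subst n.
have e_gt1: (1 < e)%N by rewrite -(ltn_pmul2r d_gt0) mul1n.
rewrite bigomegaM ?(ltnW e_gt1) // -[X in (X < _)%N]add0n ltn_add2r.
exact: bigomega_gt0.
Qed.

Lemma bigomega_prod (omega : nat) (p alpha : 'I_omega -> nat) :
  (forall k, prime (p k)) ->
  bigomega (\prod_(k < omega) p k ^ alpha k) = (\sum_(k < omega) alpha k)%N.
Proof.
move=> p_pr.
(* Additivity of [bigomega] needs positive arguments, so positivity of the
   partial products is carried along. *)
pose Q m s := (0 < m)%N /\ bigomega m = s.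
suff []: Q (\prod_(k < omega) p k ^ alpha k)%N
           (\sum_(k < omega) alpha k)%N by [].
apply: (big_ind2 Q) => [|m s n t [m_gt0 <-] [n_gt0 <-]|k _].
- by split; rewrite ?bigomega1.
- by split; rewrite ?muln_gt0 ?m_gt0 ?bigomegaM.
split; first by rewrite expn_gt0 prime_gt0.
elim: (alpha k) => [|a IHa]; first by rewrite bigomega1.
by rewrite expnS bigomegaM ?expn_gt0 ?prime_gt0 // bigomega_prime // IHa.
Qed.

(** The expansion of [(T - 1)^i 1] by the binomial theorem; its value at [n] is
    the number of chains of [i] successive proper divisors below [n]. *)
Definition strict_chains (i n : nat) : int :=
  \sum_(j < i.+1) (-1) ^+ (i - j) * ('C(i, j))%:Z * (divisor_chains j n)%:Z.

Lemma strict_chains0 (n : nat) : strict_chains 0 n = 1.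
Proof. by rewrite /strict_chains big_ord1 bin0 !mulr1. Qed.

Lemma strict_chainsS (i n : nat) :
  (0 < n)%N ->
  strict_chains i.+1 n = \sum_(1 <= d < n | (d %| n)%N) strict_chains i d.
Proof.
move=> n_gt0.
rewrite /strict_chains (binomial_differenceS (fun j => (divisor_chains j n)%:Z)).
rewrite exchange_big /=; apply: eq_bigr => j _; rewrite -mulr_sumr.
congr (_ * _); rewrite /= eq_sum_divisors // PoszD addrC addKr.
by rewrite -natz natr_sum; apply: eq_bigr => d _; rewrite natz.
Qed.

(** By induction on [m]: a proper divisor of [n] has fewer prime factors than
    [n], so the induction hypothesis, with one summand fewer, applies to every
    term of the recursion for [kappa0 n]. *)
Lemma kappa0_strict_chains (m n : nat) :
  (0 < n)%N -> (bigomega n < m)%N ->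
  (kappa0 n)%:Z = \sum_(i < m) strict_chains i n.
Proof.
elim: m n => // m IHm n n_gt0 lt_nm.
rewrite kappa0E // big_ord_recl strict_chains0 PoszD; congr (_ + _).
under [RHS]eq_bigr => i _ do rewrite strict_chainsS //.
rewrite exchange_big /= -natz natr_sum big_nat_cond [RHS]big_nat_cond.
apply: eq_bigr => d /andP[dP dn]; rewrite natz IHm //.
  by case/andP: dP.
exact: leq_trans (ltn_bigomega _ _ dP dn) lt_nm.
Qed.

(** Adding [eps] corrects the exception [kappa0 1 = K 1], and makes the relation
    stable under the two recursions without any case distinction. *)
Lemma kappa0_eps (n : nat) : (0 < n)%N -> (kappa0 n + eps n = 2 * K n)%N.
Proof.
elim/ltn_ind: n => n IHn n_gt0.
have sum_eps: (\sum_(1 <= d < n | d %| n) eps d + eps n = 1)%N.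
  rewrite addnC; transitivity (\sum_(d <- divisors n) eps d)%N.
    by rewrite (eq_sum_divisors _ n eps).
  rewrite (bigD1_seq 1%N) ?divisor1 ?divisors_uniq //=.
  by rewrite big1 // => d; rewrite /eps => /negPf->.
have sumK: (\sum_(1 <= d < n | d %| n) kappa0 d
    + \sum_(1 <= d < n | d %| n) eps d = 2 * \sum_(1 <= d < n | d %| n) K d)%N.
  rewrite -big_split big_distrr /= big_nat_cond [RHS]big_nat_cond.
  by apply: eq_bigr => d /andP[/andP[d_gt0 lt_dn] _]; apply: IHn.
rewrite kappa0E // KE //; lia.
Qed.

Theorem theorem2 (n : nat) (hn : (1 <= n)%N)
    (omega : nat) (p alpha : 'I_omega -> nat)
    (p_prime : forall k : 'I_omega, prime (p k))
    (p_distinct : injective p)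
    (alpha_ge1 : forall k : 'I_omega, (1 <= alpha k)%N)
    (n_fact : n = (\prod_(k < omega) p k ^ alpha k)%N) :
  let Omega := (\sum_(k < omega) alpha k)%N in
  let S : int :=
    \sum_(i < Omega.+1) \sum_(j < i.+1)
      (-1) ^+ (i - j) * ('C(i, j))%:Z
        * \prod_(k < omega) ('C(alpha k + j, alpha k))%:Z in
  (kappa0 n)%:Z = S /\
  ((2 <= n)%N -> kappa0 n = (2 * K n)%N /\ (2 * K n)%:Z = S).
Proof.
move=> Omega S.
have kappa0S: (kappa0 n)%:Z = S.
  rewrite (kappa0_strict_chains Omega.+1) //; last first.
    by rewrite n_fact bigomega_prod.
  apply: eq_bigr => i _; apply: eq_bigr => j _; congr (_ * _).
  rewrite n_fact divisor_chains_prod // -natz natr_prod.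
  by apply: eq_bigr => k _; rewrite natz.
split=> // n_ge2.
have kappa0K: kappa0 n = (2 * K n)%N.
  by rewrite -kappa0_eps // /eps gtn_eqF // addn0.
by rewrite -kappa0K.
Qed.
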